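(* Let $f(x)=x^TAx+2a^Tx+c$ and $h(x)=x^TBx+2b^Tx+d$ be quadratic functions on $\mathbb{R}^n$, where $A,B$ are real symmetric $n\times n$ matrices, $a,b\in\mathbb{R}^n$ and $c,d\in\mathbb{R}$. Suppose $B\neq 0$ and that $h$ takes both positive and negative values, i.e. there are $x',x''\in\mathbb{R}^n$ with $h(x')<0<h(x'')$. Then the following four values in $[-\infty,+\infty)$ are equal: (1) $\inf\{f(x): h(x)=0,\ x\in\mathbb{R}^n\}$; (2) the Lagrangian dual value $\displaystyle\sup_{\mu\in\mathbb{R}}\ \inf_{x\in\mathbb{R}^n}\{f(x)+\mu h(x)\}$; (3) $\displaystyle\sup_{s,\mu\in\mathbb{R}}\left\{s:\ \left[\begin{array}{cc}A+\mu B& a+\mu b\\ a^T+\mu b^T& c+\mu d-s\end{array}\right]\succeq 0\right\}$; (4) $\displaystyle\inf_{X\in S_+^{n+1}}\left\{\left[\begin{array}{cc}A & a \\ a^T & c\end{array}\right]\bullet X:\ \left[\begin{array}{cc}B & b \\ b^T & d\end{array}\right]\bullet X=0,\ X_{n+1,n+1}=1\right\}$.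
   Context: $S_+^{n+1}$ is the set of real symmetric positive semidefinite $(n+1)\times(n+1)$ matrices; $X\succeq 0$ means $X$ is positive semidefinite; $M\bullet N=\mathrm{Tr}(MN^T)$ is the standard inner product of matrices. The supremum of the empty set is $-\infty$. *)

(* Defs.v *)
From HB Require Import structures.
From mathcomp Require Import all_boot all_order all_algebra.
From mathcomp Require Import all_classical all_reals ereal.

Set Implicit Arguments.
Unset Strict Implicit.
Unset Printing Implicit Defensive.

Import Order.TTheory GRing.Theory Num.Theory.

Local Open Scope ring_scope.

Definition quadf (R : realType) (n : nat)
    (A : 'M[R]_n) (a : 'cV[R]_n) (c : R) (x : 'cV[R]_n) : R :=
  (x^T *m A *m x) 0 0 + 2 * (a^T *m x) 0 0 + c.

(* The symmetric matrix M with [quadf A a c x] = [x; 1]^T M [x; 1], for A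
   symmetric. *)
Definition quadmx (R : realType) (n : nat)
    (A : 'M[R]_n) (a : 'cV[R]_n) (c : R) : 'M[R]_(n + 1) :=
  block_mx A a a^T c%:M.

Definition psdmx (R : realType) (m : nat) (M : 'M[R]_m) : Prop :=
  M^T = M /\ forall x : 'cV[R]_m, 0 <= (x^T *m M *m x) 0 0.

Definition mxinner (R : realType) (m : nat) (M N : 'M[R]_m) : R :=
  \tr (M *m N^T).

(* Main.v *)
(** The only gap-closing step is the S-lemma with equality: if [f >= 0] on
    [h = 0], then [f + mu h >= 0] everywhere for some [mu].  Such a [mu] (the
    supremum of [- f / h] over [h > 0]) exists as soon as
    [h x * f y - h y * f x >= 0] whenever [h y < 0 < h x].  When [h] is truly
    quadratic on the line through [x] and [y], it has two roots there; modulo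
    [h], [f] is affine on that line and nonnegative at both roots, and the
    inequality follows.  The remaining pairs are limits of such ones because
    [B <> 0].  Everything else is weak duality: a positive semidefinite matrix
    is a sum of rank-one matrices, so two of them have nonnegative inner
    product, and the matrices of rank one [(x, 1) (x, 1)^T] embed the primal
    problem into its semidefinite relaxation. *)
Require Import Defs.
From HB Require Import structures.
From mathcomp Require Import all_boot all_order all_algebra.
From mathcomp Require Import all_classical all_reals ereal.
From mathcomp Require Import ring lra.

Set Implicit Arguments.
Unset Strict Implicit.
Unset Printing Implicit Defensive.

Import Order.TTheory GRing.Theory Num.Theory.

Local Open Scope classical_set_scope.
Local Open Scope ring_scope.

(** * Restriction to lines and quadratics in one variable *)

Lemma quadf_line (R : realType) (n : nat) (A : 'M[R]_n) (a : 'cV[R]_n) (c : R)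
    (x v : 'cV[R]_n) :
  exists k, forall t, quadf A a c (x + t *: v) =
    quadf A a c x + t * k + t ^+ 2 * (v^T *m A *m v) 0 0.
Proof.
exists ((x^T *m A *m v) 0 0 + (v^T *m A *m x) 0 0 + 2 * (a^T *m v) 0 0) => t.
rewrite /quadf !raddfD /= !linearZ /= !mulmxDl -!scalemxAl /= !mxE; ring.
Qed.

Lemma quadratic_near (R : realFieldType) (p q r : R) : r < 0 ->
  exists2 e, 0 < e & forall t, 0 < t -> t < e -> r + t * p + t ^+ 2 * q < 0.
Proof.
move=> r0; have pq : 0 < 1 + `|p| + `|q| by have := normr_ge0 p; have := normr_ge0 q; lra.
(* For [t < 1] the perturbation is at most [t * (|p| + |q|)]; the added 1 keeps the denominator
   positive. *)
exists (Num.min 1 (- r / (1 + `|p| + `|q|))).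
  by rewrite lt_min ltr01 divr_gt0 // oppr_gt0.
move=> t t0; rewrite lt_min ltr_pdivlMr // => /andP[t1 tr].
have tp : t * p <= t * `|p| by rewrite ler_pM2l // ler_norm.
have tq : t ^+ 2 * q <= t * `|q|.
  apply: (@le_trans _ _ (t ^+ 2 * `|q|)).
    by rewrite ler_pM2l ?exprn_gt0 // ler_norm.
  by rewrite ler_wpM2r // expr2 ger_pMl // ltW.
lra.
Qed.

(** A nonzero quadratic has at most two roots, so one of [e / 2], [e / 3], [e / 4] is not a root. *)
Lemma quadratic_neq0_near (R : realFieldType) (p q r e : R) : q != 0 -> 0 < e ->
  exists t, [/\ 0 < t, t < e & r + t * p + t ^+ 2 * q != 0].
Proof.
move=> q0 e0; apply: contrapT => H.
have Z k : (0 < k)%N -> r + e / k.+1%:R * p + (e / k.+1%:R) ^+ 2 * q = 0.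
  move=> k0; apply: contrapT => /eqP N; apply: H; exists (e / k.+1%:R); split => //.
    by rewrite divr_gt0 // ltr0n.
  by rewrite ltr_pdivrMr ?ltr0n // ltr_pMr // ltr1n.
have := Z 1%N isT; have := Z 2%N isT; have := Z 3%N isT => Z3 Z2 Z1.
have : e ^+ 2 * q = 0 by lra.
by move/eqP; rewrite mulf_eq0 expf_eq0 /= gt_eqF //= (negPf q0).
Qed.

Lemma quadratic_ge0_lead (R : realFieldType) (p q r : R) :
  (forall t, 0 <= r + t * p + t ^+ 2 * q) -> 0 <= q.
Proof.
move=> H; rewrite leNgt; apply/negP => q0.
have r0 : 0 <= r by have := H 0; lra.
(* Adding the values at [s] and [- s] cancels [p], while [1 <= s] and [q < 0] give
   [r + s ^+ 2 * q <= r + s * q = q < 0]. *)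
set s := 1 + r / - q.
have s1 : 1 <= s by rewrite lerDl divr_ge0 // oppr_ge0 ltW.
have sq : s * q = q - r by rewrite /s mulrDl invrN mulrN mulNr divfK ?lt_eqF //; ring.
have := H s; have := H (- s); nra.
Qed.

Lemma quadratic_root01 (R : rcfType) (p q r : R) :
  0 < r -> r + p + q < 0 ->
  exists t, [/\ 0 < t, t < 1 & r + t * p + t ^+ 2 * q = 0].
Proof.
move=> r0 r1.
have E (t : R) : (- (r%:P + p *: 'X + q *: 'X^2)).[t] = - (r + t * p + t ^+ 2 * q).
  by rewrite !hornerE /=; ring.
have [| |t /andP[t0 t1] /rootP] := @poly_ivt _ (- (r%:P + p *: 'X + q *: 'X^2)) 0 1.
- exact: ler01.
- by rewrite !E; apply/andP; split; lra.
rewrite E => /eqP; rewrite oppr_eq0 => /eqP Z; exists t; split=> //; rewrite lt_neqAle ?t0 ?t1 andbT.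
  by apply/eqP => t00; move: Z; rewrite -t00; lra.
by apply/eqP => t00; move: Z; rewrite t00; lra.
Qed.

(* One-dimensional case: [l] is the affine function agreeing with the first
   quadratic at the two roots of the second. *)
Lemma quadratic_pair (R : rcfType) (p q r p' q' r' : R) :
  q' != 0 -> 0 < r' -> r' + p' + q' < 0 ->
  (forall t, r' + t * p' + t ^+ 2 * q' = 0 -> 0 <= r + t * p + t ^+ 2 * q) ->
  0 <= r' * (r + p + q) - (r' + p' + q') * r.
Proof.
move=> q0 r0 r1 H.
have [t [t0 t1 tZ]] := @quadratic_root01 _ _ _ _ r0 r1.
(* Vieta: [u] is the second root, so the second quadratic is [q' (X - t) (X - u)]. *)
have [u pE] : exists u, p' = - q' * (t + u).
  by exists (- p' / q' - t); field.
have rE : r' = q' * (t * u).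
  by move: tZ; rewrite pE; lra.
have uZ : r' + u * p' + u ^+ 2 * q' = 0.
  by rewrite pE rE; ring.
have Ht := H t tZ; have Hu := H u uZ.
(* The values [q' t u > 0] at 0 and [q' (1 - t) (1 - u) < 0] at 1 force [u] and [u - 1] to have the
   sign of [q']; hence [u] lies outside [[0, 1]]. *)
have qu : 0 < q' * u by move: r0; rewrite rE; nra.
have qu1 : 0 < q' * (u - 1).
  have : 0 < (q' * (u - 1)) * (1 - t) by move: r1; rewrite pE rE; lra.
  by rewrite pmulr_lgt0 //; lra.
have ut : 0 < q' * (u - t).
  have -> : q' * (u - t) = t * (q' * (u - 1)) + (1 - t) * (q' * u) by ring.
  by apply: addr_gt0; apply: mulr_gt0 => //; lra.
have uu : 0 < u * (u - 1).
  have : 0 < q' ^+ 2 * (u * (u - 1)) by nra.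
  by rewrite pmulr_rgt0 // exprn_even_gt0.
have tt : 0 < t * (1 - t) by apply: mulr_gt0 => //; lra.
have utq : 0 < (u - t) ^+ 2.
  by rewrite exprn_even_gt0 //=; apply/eqP => E; move: ut; rewrite E; lra.
(* Interpolation at the roots: the target is a combination of the first quadratic's values at [t]
   and [u], with positive weights; the square clears denominators. *)
rewrite -(pmulr_rge0 _ utq).
have -> : (u - t) ^+ 2 * (r' * (r + p + q) - (r' + p' + q') * r) =
   (q' * (u - t)) * ((r + t * p + t ^+ 2 * q) * (u * (u - 1))
      + (r + u * p + u ^+ 2 * q) * (t * (1 - t))).
  by rewrite pE rE; ring.
by apply: mulr_ge0; [exact: ltW|apply: addr_ge0; apply: mulr_ge0 => //; exact: ltW].
Qed.

(** * The S-lemma with equality *)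

Lemma sym_form_neq0 (R : realFieldType) (n : nat) (B : 'M[R]_n) :
  B^T = B -> B <> 0 -> exists w : 'cV[R]_n, (w^T *m B *m w) 0 0 != 0.
Proof.
move=> sB B0; apply: contrapT => H.
have Z (w : 'cV[R]_n) : (w^T *m B *m w) 0 0 = 0.
  by apply: contrapT => /eqP N; apply: H; exists w.
have Zij i j : ((delta_mx i 0 : 'cV[R]_n)^T *m B *m (delta_mx j 0 : 'cV[R]_n)) 0 0 = B i j.
  by rewrite trmx_delta -rowE -colE !mxE.
apply: B0; apply/matrixP => i j; rewrite [RHS]mxE.
(* Polarization: the value at [e_i + e_j] is [2 * B i j] once the diagonal is known to vanish. *)
have := Z (delta_mx i 0 + delta_mx j 0).
rewrite [(_ + _)^T]raddfD /= !(mulmxDl, mulmxDr).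
rewrite [X in X = _ -> _]mxE [X in X + _]mxE [X in _ + X]mxE !Zij.
have diag k : B k k = 0 by rewrite -Zij Z.
rewrite !diag.
have -> : B j i = B i j by rewrite -[in LHS]sB mxE.
lra.
Qed.

Section Pair.
Context (R : realType) (n : nat) (A B : 'M[R]_n) (a b : 'cV[R]_n) (c d : R).
Let f := quadf A a c.
Let h := quadf B b d.
Hypothesis (fP : forall x, h x = 0 -> 0 <= f x).

Lemma quadf_pair_aux (x y : 'cV[R]_n) :
  ((y - x)^T *m B *m (y - x)) 0 0 != 0 -> 0 < h x -> h y < 0 ->
  0 <= h x * f y - h y * f x.
Proof.
move=> q0 hx hy.
have [k kE] := quadf_line A a c x (y - x).
have [l lE] := quadf_line B b d x (y - x).
have yE : y = x + 1 *: (y - x) by rewrite scale1r addrC subrK.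
have fy : f y = f x + k + ((y - x)^T *m A *m (y - x)) 0 0.
  by rewrite {1}yE /f kE mul1r expr1n mul1r.
have hyE : h y = h x + l + ((y - x)^T *m B *m (y - x)) 0 0.
  by rewrite {1}yE /h lE mul1r expr1n mul1r.
rewrite fy hyE; apply: quadratic_pair => //; first by rewrite -hyE.
by move=> t; rewrite -lE -kE; exact: fP.
Qed.

(* If [h] is affine on the line through [x] and [y], move [y] slightly along a
   direction on which the form [B] does not vanish. *)
Lemma quadf_pair (x y : 'cV[R]_n) : B^T = B -> B <> 0 -> 0 < h x -> h y < 0 ->
  0 <= h x * f y - h y * f x.
Proof.
move=> sB B0 hx hy; rewrite leNgt; apply/negP => N.
have [w w0] := sym_form_neq0 sB B0.
have [k kE] := quadf_line A a c y w; have [l lE] := quadf_line B b d y w.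
(* The form [B] at [y - x + t *: w] is a quadratic in [t] with leading coefficient [w^T B w], hence
   nonzero for some small [t]. *)
have [m mE] := quadf_line B 0 0 (y - x) w.
have form0 v : quadf B 0 0 v = (v^T *m B *m v) 0 0.
  by rewrite /quadf trmx0 mul0mx [X in 2 * X]mxE mulr0 !addr0.
have [e1 e10 E1] := @quadratic_near _ l ((w^T *m B *m w) 0 0) _ hy.
(* These are the coefficients in [t] of [h x * f (y + t *: w) - h (y + t *: w) * f x], so its
   assumed negativity at [t = 0] persists. *)
have [e2 e20 E2] := @quadratic_near _ (h x * k - l * f x)
  (h x * (w^T *m A *m w) 0 0 - (w^T *m B *m w) 0 0 * f x) _ N.
have e0 : 0 < Num.min e1 e2 by rewrite lt_min e10.
have [t [t0]] := @quadratic_neq0_near _ m _ (quadf B 0 0 (y - x)) _ w0 e0.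
rewrite lt_min => /andP[te1 te2]; rewrite -mE form0 => tN.
have := E1 t t0 te1; rewrite -lE => hy'.
have := E2 t t0 te2; have : 0 <= h x * f (y + t *: w) - h (y + t *: w) * f x.
  by apply: quadf_pair_aux => //; rewrite addrAC.
rewrite /f /h kE lE -/f -/h; lra.
Qed.

Lemma quadf_multiplier : B^T = B -> B <> 0 ->
  (exists x, 0 < h x) -> (exists y, h y < 0) ->
  exists mu, forall x, 0 <= f x + mu * h x.
Proof.
move=> sB B0 [x0 hx0] [y0 hy0].
pose S := [set - f x / h x | x in [set x | 0 < h x]].
(* These bounds serve twice: they make the supremum finite, and [sup S <= f y / - h y] is the
   desired inequality at a point where [h] is negative. *)
have ub y : h y < 0 -> ubound S (f y / - h y).
  move=> hy _ [x /= hx <-].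
  rewrite ler_pdivlMr ?oppr_gt0 // mulrAC ler_pdivrMr //.
  by have := quadf_pair sB B0 hx hy; lra.
have S0 : S !=set0 by exists (- f x0 / h x0), x0.
exists (sup S) => x; have [hx|hx|hx] := ltgtP (h x) 0.
- have := ge_sup S0 (ub _ hx); rewrite ler_pdivlMr ?oppr_gt0 //; lra.
- have : - f x / h x <= sup S.
    by apply: ub_le_sup; [exists (f y0 / - h y0); exact: ub|exists x].
  by rewrite ler_pdivrMr //; lra.
by rewrite hx mulr0 addr0 fP.
Qed.

End Pair.

(** * Positive semidefinite matrices *)

Lemma mx11_tr (T : Type) (M : 'M[T]_1) : M^T = M.
Proof. by apply/matrixP => i j; rewrite mxE !ord1. Qed.

Lemma cV_norm2_gt0 (R : realDomainType) (n : nat) (u : 'cV[R]_n) :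
  (0 < (u^T *m u) 0 0) = (u != 0).
Proof.
have sq i : 0 <= u^T 0 i * u i 0 by rewrite mxE -expr2 sqr_ge0.
rewrite lt_neqAle mxE sumr_ge0 // andbT eq_sym; congr (~~ _).
apply/eqP/eqP => [/psumr_eq0P Z|->]; last first.
  by apply: big1 => i _; rewrite [X in _ * X]mxE mulr0.
apply/colP => i; have := Z (fun i _ => sq i) i isT.
by rewrite mxE -expr2 mxE => /eqP; rewrite sqrf_eq0 => /eqP.
Qed.

Lemma quadmx_form (R : realType) (n : nat) (A : 'M[R]_n) (a : 'cV[R]_n) (c : R)
    (y : 'cV[R]_n) (t : R) :
  ((col_mx y t%:M)^T *m quadmx A a c *m col_mx y t%:M) 0 0 =
    (y^T *m A *m y) 0 0 + 2 * t * (a^T *m y) 0 0 + t ^+ 2 * c.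
Proof.
rewrite /quadmx tr_col_mx mul_row_block mul_row_col !mulmxDl tr_scalar_mx.
rewrite !mul_mx_scalar !mul_scalar_mx -!scalemxAl.
have -> : y^T *m a = a^T *m y by rewrite -[RHS]mx11_tr trmx_mul trmxK.
by rewrite !mxE /= mulr1n; ring.
Qed.

(** Homogeneity reduces a vector [(y, t)] with [t != 0] to [(y / t, 1)]. For [t = 0], [y^T A y] is
    the leading coefficient of the nonnegative quadratic [s |-> quadf A a c (s *: y)]. *)
Lemma quadmx_psd (R : realType) (n : nat) (A : 'M[R]_n) (a : 'cV[R]_n) (c : R) :
  A^T = A -> (psdmx (quadmx A a c) <-> forall x, 0 <= quadf A a c x).
Proof.
have formE x : quadf A a c x = ((col_mx x 1%:M)^T *m quadmx A a c *m col_mx x 1%:M) 0 0.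
  by rewrite quadmx_form expr1n mulr1 mul1r.
move=> sA; split=> [[_ H] x|H]; first by rewrite formE.
split; first by rewrite /quadmx tr_block_mx sA trmxK tr_scalar_mx.
move=> v; rewrite -[v]vsubmxK; set y := usubmx v.
rewrite [dsubmx v]mx11_scalar; set t := dsubmx v 0 0; rewrite quadmx_form.
have [->|t0] := eqVneq t 0.
  rewrite mulr0 expr0n /= !mul0r !addr0.
  have [k kE] := quadf_line A a c 0 y.
  by apply: (@quadratic_ge0_lead _ k _ (quadf A a c 0)) => s; rewrite -kE.
have := H (t^-1 *: y); rewrite /quadf !linearZ /= -!(scalemxAl, scalemxAr).
rewrite scalerA [X in X + _ + _]mxE [X in 2 * X]mxE.
have t2 : 0 < t ^+ 2 by rewrite exprn_even_gt0.
rewrite -(pmulr_rge0 _ t2); set k := (a^T *m y) 0 0; set l := (y^T *m A *m y) 0 0.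
by congr (0 <= _); field.
Qed.

Lemma mxinner_rank1 (R : realType) (m : nat) (M : 'M[R]_m) (v : 'cV[R]_m) :
  mxinner M (v *m v^T) = (v^T *m M *m v) 0 0.
Proof.
by rewrite /mxinner trmx_mul trmxK mulmxA mxtrace_mulC mulmxA /mxtrace big_ord1.
Qed.

(** Induction by Schur complement: a rank-one matrix built from the last column is split off,
    leaving a smaller semidefinite block bordered by zeros. *)
Lemma psdmx_rank1_sum (R : realType) (m : nat) (X : 'M[R]_m) : psdmx X ->
  exists s : seq 'cV[R]_m, X = \sum_(v <- s) v *m v^T.
Proof.
elim: m X => [|m IH].
  by move=> X _; exists [::]; rewrite big_nil; apply/matrixP => -[].
rewrite -[m.+1]addn1 => X [sX pX].
pose x := drsubmx X 0 0; pose u := ursubmx X; pose Y := ulsubmx X.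
have XE : X = quadmx Y u x.
  rewrite -{1}[X]submxK /quadmx /x -mx11_scalar; congr block_mx.
  by rewrite /u trmx_ursub sX.
have sY : Y^T = Y by rewrite /Y trmx_ulsub sX.
have form (y : 'cV_m) t := pX (col_mx y t%:M).
rewrite XE in form.
have x0 : 0 <= x.
  by have := form 0 1; rewrite quadmx_form !mulmx0 !mxE; lra.
(* Since [0^-1 = 0], this says [u = 0] when [x = 0], and lets both cases be treated uniformly
   below. *)
have ux : x^-1 * x *: u = u.
  have [x00|xN] := eqVneq x 0; last by rewrite mulVf // scale1r.
  suff -> : u = 0 by rewrite scaler0.
  apply/eqP; rewrite -[_ == _]negbK -cV_norm2_gt0; apply/negP => uu.
  (* With [x = 0] the form is affine in the last coordinate; this choice makes its value
     [l - (l + 1) = -1]. *)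
  have := form u (- ((u^T *m Y *m u) 0 0 + 1) / (2 * (u^T *m u) 0 0)).
  rewrite quadmx_form x00; set k := (u^T *m u) 0 0 in uu *.
  set l := (u^T *m Y *m u) 0 0.
  have -> : 2 * (- (l + 1) / (2 * k)) * k = - (l + 1) by field; rewrite gt_eqF.
  lra.
have uk (y : 'cV_m) : x^-1 * x * (u^T *m y) 0 0 = (u^T *m y) 0 0.
  by rewrite -[in RHS]ux linearZ /= -scalemxAl [RHS]mxE.
pose Z := Y - x^-1 *: (u *m u^T).
have pZ : psdmx Z.
  split; first by rewrite /Z raddfB /= sY linearZ /= trmx_mul trmxK.
  (* For [x > 0] this last coordinate minimizes the form of [X], and the minimum is [y^T Z y]. *)
  move=> y; have := form y (- (x^-1 * (u^T *m y) 0 0)); rewrite quadmx_form.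
  have -> : y^T *m Z *m y = y^T *m Y *m y - x^-1 *: ((y^T *m u) *m (u^T *m y)).
    by rewrite /Z mulmxBr mulmxBl -scalemxAr -scalemxAl !mulmxA.
  have -> : y^T *m u = u^T *m y by rewrite -[RHS]mx11_tr trmx_mul trmxK.
  move=> H; rewrite [_ 0 0]mxE [X in _ + X]mxE [X in - X]mxE [X in _ * X]mxE big_ord1.
  move: H; set k := (u^T *m y) 0 0; set l := (y^T *m Y *m y) 0 0.
  have -> : (- (x^-1 * k)) ^+ 2 * x = (x^-1 * k) * (x^-1 * x * k) by ring.
  rewrite uk -/k; lra.
have [s sE] := IH _ pZ.
(* The first vector contributes the blocks [x^-1 u u^T], [u], [u^T] and [x]; it is zero when
   [x = 0]. *)
exists ((Num.sqrt x)^-1 *: col_mx u x%:M :: [seq col_mx w 0 | w <- s]).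
rewrite big_cons big_map.
have -> : \sum_(w <- s) col_mx w 0 *m (col_mx w 0)^T =
    block_mx Z 0 0 0 :> 'M[R]_(m + 1).
  rewrite sE; elim: s {sE} => [|w s IHs].
    by rewrite !big_nil -[LHS]submxK; congr block_mx; apply/matrixP => i j; rewrite !mxE.
  rewrite !big_cons IHs (tr_col_mx w 0) mul_col_row add_block_mx trmx0 !mul0mx !mulmx0.
  by rewrite !addr0.
rewrite linearZ /= -scalemxAl -scalemxAr scalerA -invfM -expr2 sqr_sqrtr //.
rewrite tr_col_mx mul_col_row scale_block_mx add_block_mx !addr0 /Z.
rewrite addrC subrK tr_scalar_mx mul_mx_scalar mul_scalar_mx -scalar_mxM !scale_scalar_mx.
rewrite {1}XE /quadmx !scalerA !ux.
congr block_mx; first by rewrite -linearZ /= ux.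
by rewrite mulrA; have [->|xN] := eqVneq x 0; rewrite ?mulr0 // mulVf // mul1r.
Qed.

Lemma mxinner_psd_ge0 (R : realType) (m : nat) (M X : 'M[R]_m) :
  psdmx M -> psdmx X -> 0 <= mxinner M X.
Proof.
move=> [_ pM] /psdmx_rank1_sum[s ->].
rewrite /mxinner raddf_sum /= mulmx_sumr raddf_sum sumr_ge0 // => v _.
by have := pM v; rewrite -mxinner_rank1.
Qed.

Lemma psdmx_rank1 (R : realType) (m : nat) (v : 'cV[R]_m) : psdmx (v *m v^T).
Proof.
split=> [|x]; first by rewrite trmx_mul trmxK.
rewrite mulmxA -mulmxA -[x^T *m v]mx11_tr trmx_mul trmxK mxE big_ord1.
by rewrite -expr2 sqr_ge0.
Qed.

(** * The Lagrangian and the comparison of the four values *)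

Lemma quadfD (R : realType) (n : nat) (A B : 'M[R]_n) (a b x : 'cV[R]_n)
    (c d mu s : R) :
  quadf (A + mu *: B) (a + mu *: b) (c + mu * d - s) x =
    quadf A a c x + mu * quadf B b d x - s.
Proof.
rewrite /quadf [(a + _)^T]raddfD /= linearZ /= mulmxDr !mulmxDl -scalemxAr.
rewrite -!scalemxAl !mxE; ring.
Qed.

(** The intermediate value theorem on the segment from [y] to [x]; it makes the primal problem
    feasible. *)
Lemma quadf_zero (R : realType) (n : nat) (B : 'M[R]_n) (b x y : 'cV[R]_n) (d : R) :
  quadf B b d x < 0 -> 0 < quadf B b d y -> exists z, quadf B b d z = 0.
Proof.
move=> hx hy; have [k kE] := quadf_line B b d y (x - y).
have yE : quadf B b d x = quadf B b d y + k + ((x - y)^T *m B *m (x - y)) 0 0.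
  by have := kE 1; rewrite scale1r addrC subrK mul1r expr1n mul1r.
rewrite yE in hx; have [t [_ _ Z]] := quadratic_root01 hy hx.
by exists (y + t *: (x - y)); rewrite kE.
Qed.

Lemma mxinner_quadmx (R : realType) (n : nat) (A B : 'M[R]_n) (a b : 'cV[R]_n)
    (c d mu s : R) (X : 'M[R]_(n + 1)) :
  mxinner (quadmx (A + mu *: B) (a + mu *: b) (c + mu * d - s)) X =
    mxinner (quadmx A a c) X + mu * mxinner (quadmx B b d) X
      - s * X (rshift n ord0) (rshift n ord0).
Proof.
have -> : quadmx (A + mu *: B) (a + mu *: b) (c + mu * d - s) =
    quadmx A a c + mu *: quadmx B b d - s *: block_mx 0 0 0 1%:M.
  rewrite /quadmx !scale_block_mx opp_block_mx !add_block_mx.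
  rewrite !scaler0 oppr0 !addr0 raddfD /= linearZ /= !scale_scalar_mx mulr1.
  rewrite (raddfB (@scalar_mx R 1)) (raddfD (@scalar_mx R 1)).
  by rewrite !subr0.
rewrite /mxinner mulmxBl mulmxDl -!scalemxAl !raddfB /= raddfD /= !linearZ /=.
congr (_ - _ * _); rewrite -[X]submxK tr_block_mx mulmx_block !mul0mx !add0r.
rewrite mxtrace_block mxtrace0 add0r mul1mx mxtrace_tr /mxtrace big_ord1.
by rewrite block_mxEdr.
Qed.

Lemma quadmx_psd_multiplier (R : realType) (n : nat) (A B : 'M[R]_n)
    (a b : 'cV[R]_n) (c d mu s : R) : A^T = A -> B^T = B ->
  psdmx (block_mx (A + mu *: B) (a + mu *: b) (a^T + mu *: b^T) (c + mu * d - s)%:M)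
  <-> forall x, s <= quadf A a c x + mu * quadf B b d x.
Proof.
move=> sA sB; have -> : a^T + mu *: b^T = (a + mu *: b)^T by rewrite raddfD /= linearZ.
rewrite -/(quadmx _ _ _) quadmx_psd; last by rewrite raddfD /= linearZ /= sA sB.
by split=> H x; have := H x; rewrite quadfD subr_ge0.
Qed.

Theorem mainTheorem5 (R : realType) (n : nat) (A B : 'M[R]_n) (a b : 'cV[R]_n)
    (c d : R) (symA : A^T = A) (symB : B^T = B) (B_neq0 : B <> 0)
    (h_signs : exists x' x'' : 'cV[R]_n,
       quadf B b d x' < 0 /\ 0 < quadf B b d x'') :
  let f := quadf A a c in
  let h := quadf B b d in
  let primal : \bar R :=
    ereal_inf [set (f x)%:E | x in [set x : 'cV[R]_n | h x = 0]] in
  let dual : \bar R :=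
    ereal_sup (range (fun mu : R =>
      ereal_inf (range (fun x : 'cV[R]_n => (f x + mu * h x)%:E)))) in
  let sdp_dual : \bar R :=
    ereal_sup [set s%:E | s in [set s : R | exists mu : R,
      psdmx (block_mx (A + mu *: B) (a + mu *: b)
                      (a^T + mu *: b^T) (c + mu * d - s)%:M)]] in
  let sdp_primal : \bar R :=
    ereal_inf [set (mxinner (quadmx A a c) X)%:E | X in
      [set X : 'M[R]_(n + 1) |
        [/\ psdmx X, mxinner (quadmx B b d) X = 0
          & X (rshift n ord0) (rshift n ord0) = 1]]] in
  [/\ primal = dual, dual = sdp_dual, sdp_dual = sdp_primal
    & (primal < +oo)%E].
Proof.
move=> f h primal dual sdp_dual sdp_primal.
have [x' [x'' [hx' hx'']]] := h_signs.
(* The equalities follow from the cycles [primal <= sdp_dual <= dual <= primal] and [primal <=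
   sdp_dual <= sdp_primal <= primal]. *)
have primal_sdp_dual : (primal <= sdp_dual)%E.
  case E : primal => [s| |]; last exact: leNye.
  - apply: ereal_sup_ubound; exists s => //=.
    (* For a finite infimum [s], the S-lemma is applied to [f - s]. *)
    have fs x : h x = 0 -> 0 <= quadf A a (c - s) x.
      move=> hx; rewrite /quadf addrA subr_ge0 -lee_fin -E.
      by apply: ereal_inf_lbound; exists x.
    have [mu muP] := quadf_multiplier fs symB B_neq0
      (ex_intro _ x'' hx'') (ex_intro _ x' hx').
    exists mu; apply/quadmx_psd_multiplier => // x.
    by have := muP x; rewrite /quadf; lra.
  - have [z hz] := quadf_zero hx' hx''.
    have : (primal <= (f z)%:E)%E by apply: ereal_inf_lbound; exists z.
    by rewrite E.
have sdp_dual_dual : (sdp_dual <= dual)%E.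
  apply: ge_ereal_sup => _ [s /= [mu /quadmx_psd_multiplier H] <-].
  apply: (@le_trans _ _ (ereal_inf (range (fun x => (f x + mu * h x)%:E)))).
    by apply: le_ereal_inf_tmp => _ [x _ <-]; rewrite lee_fin; exact: H.
  by apply: ereal_sup_ubound; exists mu.
have dual_primal : (dual <= primal)%E.
  apply: ge_ereal_sup => _ [mu _ <-]; apply: le_ereal_inf_tmp => _ [x /= hx <-].
  by apply: ereal_inf_lbound; exists x => //; rewrite hx mulr0 addr0.
have sdp_dual_sdp_primal : (sdp_dual <= sdp_primal)%E.
  apply: ge_ereal_sup => _ [s /= [mu H] <-].
  apply: le_ereal_inf_tmp => _ [X [pX hX X1] <-]; rewrite lee_fin.
  have := mxinner_psd_ge0 H pX.
  have -> : a^T + mu *: b^T = (a + mu *: b)^T by rewrite raddfD /= linearZ.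
  by rewrite -/(quadmx _ _ _) mxinner_quadmx hX X1; lra.
have sdp_primal_primal : (sdp_primal <= primal)%E.
  apply: le_ereal_inf_tmp => _ [x /= hx <-].
  have E (M : 'M_n) m r :
      mxinner (quadmx M m r) (col_mx x 1%:M *m (col_mx x 1%:M)^T) = quadf M m r x.
    by rewrite mxinner_rank1 quadmx_form expr1n mulr1 mul1r.
  apply: ereal_inf_lbound; exists (col_mx x 1%:M *m (col_mx x 1%:M)^T); last by rewrite E.
  split; last 2 first.
  - by rewrite E.
  - by rewrite tr_col_mx mul_col_row block_mxEdr trmx1 mulmx1 mxE.
  exact: psdmx_rank1.
have primal_lt : (primal < +oo)%E.
  have [z hz] := quadf_zero hx' hx''.
  apply: (@le_lt_trans _ _ (f z)%:E); last exact: ltry.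
  by apply: ereal_inf_lbound; exists z.
split=> //; apply/eqP; rewrite eq_le.
- by rewrite dual_primal (le_trans primal_sdp_dual).
- by rewrite sdp_dual_dual (le_trans dual_primal).
- by rewrite sdp_dual_sdp_primal (le_trans sdp_primal_primal).
Qed.
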